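(* Let $M_1,\ldots,M_s$ be $m\times m$ positive semidefinite matrices. Let $f$ be a real function defined on $[0,\infty)$ and differentiable on $(0,\infty)$, such that $f'$ is operator antitone on $(0,\infty)$. Then the set function $F:2^{[s]}\to\mathbb{R}$ defined by $$F(I)=\operatorname{trace} f\Big(\sum_{i\in I}M_i\Big)\qquad\text{for all } I\subseteq[s]$$ is submodular.
   Context: $[s]:=\{1,\ldots,s\}$; the empty sum is the zero matrix. A real valued set function $F:2^E\to\mathbb{R}$ is submodular if $F(I)+F(J)\ge F(I\cup J)+F(I\cap J)$ for all $I,J\subseteq E$. For an $m\times m$ Hermitian matrix $A=U\operatorname{Diag}(\lambda_1,\ldots,\lambda_m)U^*$ ($U$ unitary, $U^*$ its conjugate transpose) and a real function $f$ defined at the eigenvalues of $A$, $f(A):=U\operatorname{Diag}(f(\lambda_1),\ldots,f(\lambda_m))U^*$. The Löwner ordering $A\preceq B$ means that $B-A$ is positive semidefinite. A real valued function $g$ is operator monotone on $(0,\infty)$ if for every pair of positive definite matrices $A,B$ (of the same, arbitrary, size), $A\preceq B$ implies $g(A)\preceq g(B)$; $g$ is operator antitone if $-g$ is operator monotone.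
   Formalization: Added: f is lower semicontinuous at 0 (f(0) ≤ liminf of f(x) as x→0+). Without it the claim fails: m=1, s=2, M_1=M_2=1, f(0)=1, f=0 on (0,∞); f violating it always fails for some M_i. *)

(* Defs.v *)
From mathcomp Require Import all_boot all_order all_algebra.
From mathcomp Require Export sesquilinear spectral complex.

Set Implicit Arguments.
Unset Strict Implicit.
Unset Printing Implicit Defensive.

Import Order.TTheory GRing.Theory Num.Theory.

Local Open Scope ring_scope.
Local Open Scope sesquilinear_scope.
Local Open Scope complex_scope.

Definition submodular (R : numDomainType) (E : finType) (F : {set E} -> R) :=
  forall I J : {set E}, F (I :|: J) + F (I :&: J) <= F I + F J.

Definition psdmx (R : rcfType) (n : nat) (A : 'M[R[i]]_n) : Prop :=
  A \is hermsymmx /\ forall v : 'cV[R[i]]_n, 0 <= (v ^t* *m A *m v) 0 0.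

Definition posdefmx (R : rcfType) (n : nat) (A : 'M[R[i]]_n) : Prop :=
  A \is hermsymmx /\
  forall v : 'cV[R[i]]_n, v != 0 -> 0 < (v ^t* *m A *m v) 0 0.

Definition loewner_le (R : rcfType) (n : nat) (A B : 'M[R[i]]_n) : Prop :=
  psdmx (B - A).

(* Meaningful for Hermitian A, whose spectral_diag is real. The decomposition
   used is A = U Diag(l) U^* with U = (spectralmx A)^*; [mxfunE] shows that any
   other one gives the same matrix. *)
Definition mxfun (R : rcfType) (f : R -> R) (n : nat) (A : 'M[R[i]]_n) :
    'M[R[i]]_n :=
  (spectralmx A) ^t*
  *m diag_mx (map_mx (fun z : R[i] => (f (complex.Re z))%:C) (spectral_diag A))
  *m spectralmx A.

(* Only the values of g on (0,oo) matter: these contain the spectra of A, B. *)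
Definition operator_monotone (R : rcfType) (g : R -> R) : Prop :=
  forall (n : nat) (A B : 'M[R[i]]_n), posdefmx A -> posdefmx B ->
    loewner_le A B -> loewner_le (mxfun g A) (mxfun g B).

Definition operator_antitone (R : rcfType) (g : R -> R) : Prop :=
  operator_monotone (fun x => - g x).

(* The trace of f(A) is a real number, see [trace_mxfun_real]. *)
Definition trace_mxfun (R : rcfType) (f : R -> R) (n : nat)
    (A : 'M[R[i]]_n) : R :=
  complex.Re (\tr (mxfun f A)).

Lemma mxfunE (R : rcfType) (f : R -> R) (n : nat) (U : 'M[R[i]]_n)
    (l : 'rV[R]_n) : U \is unitarymx ->
  mxfun f (U *m diag_mx (map_mx (real_complex R) l) *m U ^t*) =
  U *m diag_mx (map_mx (fun x => (f x)%:C) l) *m U ^t*.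
Proof.
move=> Uu; set L := map_mx (real_complex R) l; set A := (X in mxfun f X).
have UK : U ^t* *m U = 1%:M by rewrite -invmx_unitary // mulVmx // unitarymx_unit.
have Pu := spectral_unitarymx A; rewrite /mxfun.
set P := spectralmx A in Pu *; set D := spectral_diag A.
have PK : P ^t* *m P = 1%:M by rewrite -invmx_unitary // mulVmx // unitarymx_unit.
have PPK : P *m P ^t* = 1%:M by apply/unitarymxP.
have UUK : U *m U ^t* = 1%:M by apply/unitarymxP.
have An : A \is normalmx.
  have At : A ^t* = A.
    rewrite /A !(trmx_mul, map_mxM) trmxCK mulmxA; congr (_ *m _ *m _).
    rewrite tr_diag_mx map_diag_mx; congr diag_mx.
    by apply/rowP=> j; rewrite !mxE; apply: conj_Creal; rewrite complex_real.
  by apply/normalmxP; rewrite At.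
have AE : A = P ^t* *m diag_mx D *m P.
  by rewrite -invmx_unitary //; apply/orthomx_spectralP.
pose V := P *m U.
have VE : diag_mx D *m V = V *m diag_mx L.
  have -> : diag_mx D *m V = P *m A *m U.
    by rewrite [in RHS]AE /V !mulmxA PPK mul1mx.
  by rewrite /A -!mulmxA UK mulmx1 !mulmxA.
have fVE : diag_mx (map_mx (fun z : R[i] => (f (complex.Re z))%:C) D) *m V =
           V *m diag_mx (map_mx (fun x => (f x)%:C) l).
  clearbody V D; apply/matrixP => i j; move/matrixP/(_ i j): VE.
  rewrite !mul_diag_mx !mul_mx_diag !mxE mulrC.
  have [->|Vn0] := eqVneq (V i j) 0; first by rewrite mulr0 !mul0r.
  by move/(mulfI Vn0) => -> /=; rewrite mulrC.
rewrite -[LHS]mulmx1 -UUK mulmxA -(mulmxA _ P U) -/V -mulmxA -mulmxA.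
rewrite (mulmxA (diag_mx _) V) fVE /V !mulmxA.
by rewrite PK mul1mx.
Qed.

Lemma trace_mxfun_real (R : rcfType) (f : R -> R) (n : nat)
    (A : 'M[R[i]]_n) : (trace_mxfun f A)%:C = \tr (mxfun f A).
Proof.
rewrite /trace_mxfun /mxfun mxtrace_mulC mulmxA.
rewrite (unitarymxP (spectral_unitarymx A)) mul1mx mxtrace_diag.
under eq_bigr do rewrite mxE.
by rewrite -rmorph_sum.
Qed.

(* Main.v *)
(** Write A, B, C for the sums of the M_i over I :&: J, I :\: J and J :\: I. One
    has to show tr f(A+B+C) - tr f(A+C) <= tr f(A+B) - tr f(A). If A is positive
    definite, move from A to A+B in k equal steps X_j = A + (j/k) B and compare
    with Y_j = X_j + C. As f is concave, Klein's inequality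
      tr f(Y) - tr f(X) <= tr f'(X)(Y - X)
    bounds the increment from Y_j to Y_(j+1) above by tr f'(Y_j) B / k, hence by
    tr f'(X_j) B / k since f' is operator antitone, and bounds the increment from
    X_j to X_(j+1) below by tr f'(X_(j+1)) B / k. Summing telescopes to an error
    O(1/k), so no derivative of a trace function is ever taken. For semidefinite
    A, apply this to A + eI and let e tend to 0: nonzero eigenvalues are handled
    by continuity of f, while the zero eigenvalues are counted by the ranks,
    which are submodular. *)
Require Import Defs.
From mathcomp Require Import all_boot all_order all_algebra.
From mathcomp Require Import all_classical all_reals all_analysis.
From mathcomp Require Import zify ring lra.
Import numFieldNormedType.Exports.
Import Order.TTheory GRing.Theory Num.Theory.
Local Open Scope ring_scope.
Local Open Scope classical_set_scope.
Local Open Scope sesquilinear_scope.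
Local Open Scope complex_scope.

(** * Trace inequalities for Hermitian matrices *)

(** For Hermitian [A] these are the eigenvalues with multiplicity, as real numbers, in the order of
    the rows of [spectralmx A]. *)
Definition eigs {R : rcfType} {n} (A : 'M[R[i]]_n) : 'rV[R]_n :=
  map_mx (@complex.Re R) (spectral_diag A).

Lemma unitary_trmxCK {R : rcfType} {n} {P : 'M[R[i]]_n} :
  P \is unitarymx -> P ^t* *m P = 1%:M.
Proof. by move=> Pu; rewrite -invmx_unitary // mulVmx // unitarymx_unit. Qed.

(* [mxE] unfolds [spectral_diag], which is costly: hence the generalizations. *)
Lemma mxfun_id {R : rcfType} {n} {A : 'M[R[i]]_n} :
  A \is hermsymmx -> mxfun id A = A.
Proof.
move=> Ah; have dR := hermitian_spectral_diag_real Ah.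
have : A = (spectralmx A)^t* *m diag_mx (spectral_diag A) *m spectralmx A.
  rewrite -invmx_unitary ?spectral_unitarymx //.
  exact/orthomx_spectralP/hermitian_normalmx.
rewrite /mxfun; move: (spectralmx A) (spectral_diag A) dR => P d /mxOverP dR ->.
suff -> : map_mx (fun z : R[i] => (complex.Re (id z))%:C) d = d by reflexivity.
by apply/rowP => i; rewrite mxE; apply: RRe_real; apply: dR.
Qed.

Lemma mxfun_cst {R : rcfType} {n} c (A : 'M[R[i]]_n) :
  mxfun (fun=> c) A = (c%:C)%:M.
Proof.
rewrite /mxfun; have PK := unitary_trmxCK (spectral_unitarymx A).
move: (spectralmx A) (spectral_diag A) PK => P d PK.
have -> : diag_mx (map_mx (fun=> c%:C) d) = (c%:C)%:M.
  by rewrite -diag_const_mx; congr diag_mx; apply/rowP => i; rewrite !mxE.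
by rewrite scalar_mxC -mulmxA PK mulmx1.
Qed.

Lemma mxfun_cst1 {R : rcfType} {n} (A : 'M[R[i]]_n) : mxfun (fun=> 1) A = 1%:M.
Proof. by rewrite mxfun_cst rmorph1. Qed.

Lemma trace_mxfunE {R : rcfType} f {n} (A : 'M[R[i]]_n) :
  trace_mxfun f A = \sum_i f (eigs A 0 i).
Proof.
rewrite /trace_mxfun /mxfun mxtrace_mulC mulmxA.
rewrite (unitarymxP (spectral_unitarymx A)) mul1mx mxtrace_diag.
rewrite raddf_sum /eigs; move: (spectral_diag A) => d.
by apply: eq_bigr => i _; rewrite !mxE.
Qed.

(** [A] and [A + eI] share an eigenbasis. Since [spectralmx] may pick another one for the shifted
    matrix, [mxfunE] is what allows computing in the basis of [A]. *)
Lemma trace_mxfun_shift {R : rcfType} f {n} (A : 'M[R[i]]_n) (e : R) :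
  A \is hermsymmx ->
  trace_mxfun f (A + (e%:C)%:M) = \sum_i f (eigs A 0 i + e).
Proof.
move=> Ah.
have Pu : (spectralmx A)^t* \is unitarymx.
  by rewrite trmxC_unitary spectral_unitarymx.
have -> : A + (e%:C)%:M = (spectralmx A)^t* *m
    diag_mx (map_mx (real_complex R) (map_mx (fun x => x + e) (eigs A)))
    *m ((spectralmx A)^t*)^t*.
  rewrite trmxCK -{1}(mxfun_id Ah) -(mxfun_cst e A) /mxfun -mulmxDl -mulmxDr.
  rewrite -raddfD /= /eigs; move: (spectral_diag A) => d.
  suff -> : map_mx (fun z => (complex.Re z)%:C) d + map_mx (fun=> e%:C) d =
    map_mx (real_complex R) (map_mx (+%R^~ e) (map_mx (@complex.Re R) d)) by [].
  by apply/rowP => i; rewrite !mxE -rmorphD.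
rewrite /trace_mxfun mxfunE // trmxCK mxtrace_mulC mulmxA.
rewrite (unitarymxP (spectral_unitarymx A)) mul1mx mxtrace_diag.
rewrite raddf_sum /eigs; move: (spectral_diag A) => d.
by apply: eq_bigr => i _; rewrite !mxE.
Qed.

(* |<u_i, v_j>|^2 for eigenbases u of A and v of B. *)
Definition overlap {R : rcfType} {n} (A B : 'M[R[i]]_n) i j : R :=
  complex.Re (`|(spectralmx A *m (spectralmx B)^t*) i j| ^+ 2).

Lemma overlap_ge0 {R : rcfType} {n} (A B : 'M[R[i]]_n) i j :
  0 <= overlap A B i j.
Proof.
have : 0 <= `|(spectralmx A *m (spectralmx B)^t*) i j| ^+ 2 by rewrite exprn_ge0.
by rewrite lecE => /andP[].
Qed.

Lemma mxtrace_conj2 {K : comNzRingType} {n} (P' D P Q' E Q : 'M[K]_n) :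
  \tr (P' *m D *m P *m (Q' *m E *m Q)) =
  \tr (D *m (P *m Q') *m E *m (Q *m P')).
Proof. by rewrite -!mulmxA mxtrace_mulC !mulmxA. Qed.

(** By cyclicity the trace is that of [D W E W^t*], with [D], [E] diagonal and [W] the change of
    eigenbasis. The weights [|W_ij|^2] are the same for all [g] and [h]. *)
Lemma trace_mxfunM {R : rcfType} g h {n} (A B : 'M[R[i]]_n) :
  complex.Re (\tr (mxfun g A *m mxfun h B)) =
  \sum_i \sum_j g (eigs A 0 i) * h (eigs B 0 j) * overlap A B i j.
Proof.
rewrite /mxfun /overlap /eigs.
move: (spectral_diag A) (spectral_diag B) => d e.
move: (spectralmx A) (spectralmx B) => P Q.
set D := diag_mx _; set E := diag_mx _.
have WE : (P *m Q^t*)^t* = Q *m P^t* by rewrite trmx_mul map_mxM trmxCK.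
rewrite mxtrace_conj2 -WE.
move: (P *m Q^t*) => W; rewrite /mxtrace raddf_sum; apply: eq_bigr => i _.
rewrite mxE raddf_sum; apply: eq_bigr => j _.
rewrite /D /E mul_mx_diag mxE mul_diag_mx !mxE.
set a := g _; set b := h _; set w := W i j.
have -> : a%:C * w * b%:C * (w^*)%R = (a * b)%:C * `|w| ^+ 2.
  by rewrite normCK rmorphM /=; ring.
have : `|w| ^+ 2 \is Num.real by rewrite rpredX // normr_real.
by move=> /RRe_real <-; rewrite -rmorphM.
Qed.

Lemma eigs_quad {R : rcfType} {n} (A : 'M[R[i]]_n) i : A \is hermsymmx ->
  exists2 v : 'cV[R[i]]_n, v != 0 & (v^t* *m A *m v) 0 0 = (eigs A 0 i)%:C.
Proof.
move=> Ah; set P := spectralmx A.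
have PK : P *m P^t* = 1%:M by apply/unitarymxP; apply: spectral_unitarymx.
(* The witness is an eigenvector: column [i] of [P^t*]. *)
exists (P^t* *m delta_mx i 0).
  apply/eqP => /(congr1 (mulmx P)); rewrite mulmxA PK mul1mx mulmx0.
  by move=> /matrixP/(_ i 0); rewrite !mxE !eqxx => /eqP; rewrite oner_eq0.
rewrite -{1}(mxfun_id Ah) /mxfun /eigs -/P.
move: (spectral_diag A) => d.
clearbody P; rewrite trmx_mul map_mxM trmxCK.
rewrite !mulmxA -(mulmxA _ P) PK mulmx1 -(mulmxA _ P) PK mulmx1.
by rewrite trmx_delta map_delta_mx -rowE -colE !mxE eqxx mulr1n.
Qed.

Lemma psdmx_eigs_ge0 {R : rcfType} {n} {A : 'M[R[i]]_n} :
  psdmx A -> forall i, 0 <= eigs A 0 i.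
Proof.
by move=> [Ah Apos] i; have [v _ vE] := eigs_quad A i Ah; rewrite -ler0c -vE.
Qed.

Lemma posdefmx_eigs_gt0 {R : rcfType} {n} {A : 'M[R[i]]_n} :
  posdefmx A -> forall i, 0 < eigs A 0 i.
Proof.
move=> [Ah Apos] i; have [v v0 vE] := eigs_quad A i Ah.
by rewrite -ltcR -vE Apos.
Qed.

(** * Closure properties of Hermitian, semidefinite and definite matrices *)

Lemma hermsymmxD {C : numClosedFieldType} {n} (A B : 'M[C]_n) :
  A \is hermsymmx -> B \is hermsymmx -> A + B \is hermsymmx.
Proof.
move=> /is_hermitianmxP; rewrite expr0 scale1r => AE.
move=> /is_hermitianmxP; rewrite expr0 scale1r => BE.
by apply/is_hermitianmxP; rewrite expr0 scale1r raddfD /= map_mxD -AE -BE.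
Qed.

Lemma hermsymmxZ {R : rcfType} {n} (A : 'M[R[i]]_n) (c : R) :
  A \is hermsymmx -> c%:C *: A \is hermsymmx.
Proof.
move=> /is_hermitianmxP; rewrite expr0 scale1r => AE.
apply/is_hermitianmxP; rewrite expr0 scale1r linearZ /= map_mxZ -AE.
by congr (_ *: _); apply/esym/conj_Creal; rewrite complex_real.
Qed.

Lemma quadD {K : comNzRingType} {n} (A B : 'M[K]_n) (u : 'rV_n) (v : 'cV_n) :
  (u *m (A + B) *m v) 0 0 = (u *m A *m v) 0 0 + (u *m B *m v) 0 0.
Proof. by rewrite mulmxDr mulmxDl mxE. Qed.

Lemma psdmxD {R : rcfType} {n} (A B : 'M[R[i]]_n) :
  psdmx A -> psdmx B -> psdmx (A + B).
Proof.
move=> [Ah Ap] [Bh Bp]; split; first by apply: hermsymmxD.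
by move=> v; rewrite quadD addr_ge0.
Qed.

Lemma psdmxZ {R : rcfType} {n} (A : 'M[R[i]]_n) (c : R) :
  0 <= c -> psdmx A -> psdmx (c%:C *: A).
Proof.
move=> c0 [Ah Ap]; split; first exact: hermsymmxZ.
by move=> v; rewrite -scalemxAr -scalemxAl mxE mulr_ge0 // ler0c.
Qed.

Lemma hermsymmx_scalar {R : rcfType} {n} (c : R) :
  ((c%:C)%:M : 'M[R[i]]_n) \is hermsymmx.
Proof.
apply/is_hermitianmxP; rewrite expr0 scale1r tr_scalar_mx map_scalar_mx.
by congr (_%:M); apply/esym/conj_Creal; rewrite complex_real.
Qed.

Lemma psdmx0 {R : rcfType} {n} : psdmx (0 : 'M[R[i]]_n).
Proof.
split; last by move=> v; rewrite mulmx0 mul0mx mxE.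
by have := @hermsymmx_scalar R n 0; rewrite !raddf0.
Qed.

Lemma psdmx_sum {R : rcfType} {n} (I : finType) (P : pred I)
    (A : I -> 'M[R[i]]_n) :
  (forall i, psdmx (A i)) -> psdmx (\sum_(i | P i) A i).
Proof.
move=> Ap; elim/big_ind: _ => [|B C|i _]; [exact: psdmx0|exact: psdmxD|exact: Ap].
Qed.

Lemma quad_norm {C : numClosedFieldType} {n} (w : 'cV[C]_n) (d : 'rV[C]_n) :
  (w^t* *m diag_mx d *m w) 0 0 = \sum_i d 0 i * `|w i 0| ^+ 2.
Proof.
rewrite mxE; apply: eq_bigr => j _; rewrite mul_mx_diag !mxE.
by rewrite normCK; ring.
Qed.

Lemma posdefmx_scalar {R : rcfType} {n} (e : R) :
  0 < e -> posdefmx ((e%:C)%:M : 'M[R[i]]_n).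
Proof.
move=> e0; split; first exact: hermsymmx_scalar.
move=> v v0; rewrite -diag_const_mx quad_norm.
have [i vi0] : exists i, v i 0 != 0.
  apply/existsP; apply: contraNT v0; rewrite negb_exists => /forallP v0.
  by apply/eqP/matrixP => i j; rewrite ord1 mxE; apply/eqP/negPn/v0.
rewrite (bigD1 i) //= ltr_pwDl //.
  by rewrite mxE mulr_gt0 ?ltcR // exprn_gt0 ?normr_gt0.
by apply: sumr_ge0 => j _; rewrite mulr_ge0 ?exprn_ge0 // mxE ler0c ltW.
Qed.

Lemma posdefmxD {R : rcfType} {n} (A B : 'M[R[i]]_n) :
  posdefmx A -> psdmx B -> posdefmx (A + B).
Proof.
move=> [Ah Ap] [Bh Bp]; split; first by apply: hermsymmxD.
by move=> v v0; rewrite quadD ltr_pwDl // Ap.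
Qed.

Lemma psdmx_scalar {R : rcfType} {n} (e : R) :
  0 <= e -> psdmx ((e%:C)%:M : 'M[R[i]]_n).
Proof.
rewrite le_eqVlt => /predU1P[<-|e0]; first by rewrite raddf0; apply: psdmx0.
have [eh ep] := @posdefmx_scalar R n e e0; split=> // v.
by have [->|/ep/ltW//] := eqVneq v 0; rewrite mulmx0 mxE.
Qed.

(** * Kernels and ranks of semidefinite matrices *)

(** In an eigenbasis the form is a sum of nonnegative terms [d_i |w_i|^2], so every [d_i w_i]
    vanishes. *)
Lemma psdmx_quad_eq0 {R : rcfType} {n} {A : 'M[R[i]]_n} (v : 'cV_n) :
  psdmx A -> (v^t* *m A *m v) 0 0 = 0 -> A *m v = 0.
Proof.
move=> Ap; have := psdmx_eigs_ge0 Ap; case: Ap => Ah _.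
rewrite -{2 3}(mxfun_id Ah) /mxfun /eigs.
move: (spectralmx A) (spectral_diag A) => P d d0.
have -> : v^t* *m (P^t* *m diag_mx (map_mx (fun z => (complex.Re (id z))%:C) d)
   *m P) *m v = (P *m v)^t* *m diag_mx (map_mx (fun z => (complex.Re (id z))%:C) d)
   *m (P *m v).
  by rewrite trmx_mul map_mxM !mulmxA.
rewrite quad_norm => /eqP; rewrite psumr_eq0; last first.
  by move=> i _; rewrite mulr_ge0 ?exprn_ge0 // mxE ler0c; have := d0 i; rewrite mxE.
move=> /allP dw; rewrite -!mulmxA (_ : diag_mx _ *m _ = 0) ?mulmx0 //.
apply/matrixP => i j; rewrite ord1 mul_diag_mx [LHS]mxE [RHS]mxE.
have := dw i (mem_index_enum _); rewrite /= mulf_eq0 expf_eq0 normr_eq0 /=.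
by case/orP => /eqP ->; rewrite ?mul0r ?mulr0.
Qed.

(** The columns of [cokermx B] are killed by [B], hence by [A], and [A *m cokermx B = 0]
    characterizes inclusion of row spaces. *)
Lemma submx_ker {F : fieldType} {m n p} (A : 'M[F]_(m, n)) (B : 'M[F]_(p, n)) :
  (forall v : 'cV_n, B *m v = 0 -> A *m v = 0) -> (A <= B)%MS.
Proof.
move=> AB; rewrite submxE; have := mulmx_coker B.
move: (cokermx B) => K BK; apply/eqP/matrixP => i j.
have := AB (K *m delta_mx j 0); rewrite !mulmxA BK mul0mx.
by rewrite -colE => /(_ erefl)/matrixP/(_ i 0); rewrite [LHS]mxE => ->; rewrite !mxE.
Qed.

(** If [A + B] kills [v], both nonnegative forms vanish at [v], so [A] kills [v] too. *)
Lemma psdmx_submxD {R : rcfType} {n} (A B : 'M[R[i]]_n) :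
  psdmx A -> psdmx B -> (A <= (A + B)%R)%MS.
Proof.
move=> Ap Bp; apply: submx_ker => v ABv.
have : (v^t* *m (A + B) *m v) 0 0 = 0 by rewrite -mulmxA ABv mulmx0 mxE.
rewrite quadD => /eqP; rewrite paddr_eq0 ?(Ap.2) ?(Bp.2) // => /andP[/eqP Av0 _].
exact: psdmx_quad_eq0.
Qed.

(** Dimension formula for the row spaces of [A + B] and [A + C]: their sum contains that of
    [A + B + C], their intersection that of [A]. *)
Lemma psdmx_rank_submod {R : rcfType} {n} (A B C : 'M[R[i]]_n) :
  psdmx A -> psdmx B -> psdmx C ->
  (\rank (A + B + C)%R + \rank A <= \rank (A + B)%R + \rank (A + C)%R)%N.
Proof.
move=> Ap Bp Cp; rewrite -[leqRHS]mxrank_sum_cap.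
have AB := psdmx_submxD _ _ Ap Bp; have AC := psdmx_submxD _ _ Ap Cp.
have sub_cap : (A <= (A + B)%R :&: (A + C)%R)%MS by rewrite sub_capmx AB.
rewrite leq_add ?(mxrankS sub_cap) //; apply: mxrankS.
rewrite addmx_sub_adds //.
by rewrite addrC; apply: psdmx_submxD.
Qed.

Lemma rank_diag_mx {F : fieldType} {n} (d : 'rV[F]_n) :
  \rank (diag_mx d) = (\sum_i (d 0 i != 0)%R)%N.
Proof.
elim: n d => [|n IHn] d; first by rewrite [diag_mx d]flatmx0 mxrank0 big_ord0.
rewrite -[in LHS](@hsubmxK F 1 1 n d) (@diag_mx_row F n 1).
rewrite (@rank_diag_block_mx F 1 1 n n) IHn.
rewrite (@big_split_ord _ _ _ 1 n) big_ord1 /=; congr addn.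
  rewrite rank_rV; congr (nat_of_bool (~~ _)).
  apply/eqP/eqP => [/matrixP/(_ 0 0)|d0]; first by rewrite !mxE.
  by apply/matrixP => i j; rewrite !ord1 !mxE.
by apply: eq_bigr => i _; rewrite mxE.
Qed.

Lemma rank_eigs {R : rcfType} {n} (A : 'M[R[i]]_n) : A \is hermsymmx ->
  \rank A = #|[pred i | eigs A 0 i != 0]|.
Proof.
move=> Ah; rewrite -sum1_card big_mkcond -{1}(mxfun_id Ah) /mxfun /eigs.
have Pu := spectral_unit A.
have Pu' : (spectralmx A)^t* \in unitmx.
  by apply: unitarymx_unit; rewrite trmxC_unitary spectral_unitarymx.
move: (spectralmx A) (spectral_diag A) Pu Pu' => P d Pu Pu'.
rewrite mxrankMfree ?row_free_unit // eqmxMfull ?row_full_unit // rank_diag_mx.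
by apply: eq_bigr => i _; rewrite !inE !mxE (inj_eq (@complexI R) _ 0); case: eqP.
Qed.

(** * Klein's inequality and operator antitonicity under the trace *)

Lemma mxfunM {R : rcfType} (g h : R -> R) {n} (A : 'M[R[i]]_n) :
  mxfun g A *m mxfun h A = mxfun (fun x => g x * h x) A.
Proof.
rewrite /mxfun; have PK := unitarymxP (spectral_unitarymx A).
move: (spectralmx A) (spectral_diag A) PK => P d PK.
have -> : diag_mx (map_mx (fun z => (g (complex.Re z) * h (complex.Re z))%:C) d) =
    diag_mx (map_mx (fun z => (g (complex.Re z))%:C) d) *m
    diag_mx (map_mx (fun z => (h (complex.Re z))%:C) d).
  by rewrite mulmx_diag; congr diag_mx; apply/rowP => i; rewrite !mxE -rmorphM.
move: (diag_mx _) (diag_mx _) => D E.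
by rewrite mulmxA -(mulmxA _ P) !mulmxA -(mulmxA _ P) PK mulmx1.
Qed.

Lemma Re_mxtraceB {R : rcfType} {n} (A B : 'M[R[i]]_n) :
  complex.Re (\tr (A - B)) = complex.Re (\tr A) - complex.Re (\tr B).
Proof. by rewrite (raddfB (@mxtrace R[i] n)) /= raddfB. Qed.

(** Both sides are sums over pairs of eigenvalues with the same nonnegative overlap weights, so the
    scalar tangent inequality applies pair by pair. *)
Lemma klein {R : rcfType} (f df : R -> R) {n} (A B : 'M[R[i]]_n) :
  A \is hermsymmx -> B \is hermsymmx ->
  (forall i j, f (eigs B 0 j) - f (eigs A 0 i) <=
     df (eigs A 0 i) * (eigs B 0 j - eigs A 0 i)) ->
  trace_mxfun f B - trace_mxfun f A <=
  complex.Re (\tr (mxfun df A *m (B - A))).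
Proof.
move=> Ah Bh fdf; rewrite mulmxBr Re_mxtraceB.
(* Pairing with the constant function 1, whose matrix is the identity, turns traces that involve one
   matrix alone into double sums over both spectra. *)
have := trace_mxfunM df id A B; rewrite (mxfun_id Bh) => ->.
have := trace_mxfunM (fun x => df x * x) (fun=> 1) A B.
rewrite mxfun_cst1 mulmx1 -(mxfunM df id) (mxfun_id Ah) => ->.
have := trace_mxfunM (fun=> 1) f A B; rewrite mxfun_cst1 mul1mx => fBE.
have := trace_mxfunM f (fun=> 1) A B; rewrite mxfun_cst1 mulmx1 => fAE.
rewrite /trace_mxfun fAE fBE -2!sumrB; apply: ler_sum => i _.
rewrite -2!sumrB; apply: ler_sum => j _; rewrite -2!mulrBl.
by rewrite ler_wpM2r ?overlap_ge0 // mul1r !mulr1 -mulrBr; apply: fdf.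
Qed.

Lemma psdmx_trM_ge0 {R : rcfType} {n} (A B : 'M[R[i]]_n) :
  psdmx A -> psdmx B -> 0 <= complex.Re (\tr (A *m B)).
Proof.
move=> Ap Bp; rewrite -(mxfun_id Ap.1) -(mxfun_id Bp.1) trace_mxfunM.
apply: sumr_ge0 => i _; apply: sumr_ge0 => j _.
by rewrite !mulr_ge0 ?overlap_ge0 ?psdmx_eigs_ge0.
Qed.

Lemma mxfunN {R : rcfType} (g : R -> R) {n} (A : 'M[R[i]]_n) :
  mxfun (fun x => - g x) A = - mxfun g A.
Proof.
rewrite /mxfun -mulNmx -mulmxN -raddfN /=; move: (spectral_diag A) => d.
suff -> : map_mx (fun z : R[i] => (- g (complex.Re z))%:C) d =
  - map_mx (fun z => (g (complex.Re z))%:C) d by reflexivity.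
by apply/rowP => i; rewrite !mxE rmorphN.
Qed.

(** Antitonicity makes [g(A) - g(A + B)] positive semidefinite, and its product with [D] then has
    nonnegative trace. *)
Lemma operator_antitone_trace {R : rcfType} {g : R -> R} {n} (A B D : 'M[R[i]]_n) :
  operator_antitone g -> posdefmx A -> psdmx B -> psdmx D ->
  complex.Re (\tr (mxfun g (A + B) *m D)) <= complex.Re (\tr (mxfun g A *m D)).
Proof.
move=> hg Ap Bp Dp.
have : loewner_le A (A + B) by rewrite /loewner_le addrC addKr.
move=> /(hg _ _ _ Ap (posdefmxD _ _ Ap Bp)) AB.
have := psdmx_trM_ge0 _ _ AB Dp.
rewrite !mxfunN; move: (mxfun g A) (mxfun g (A + B)) => X Y.
by rewrite opprK addrC mulmxBl Re_mxtraceB subr_ge0.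
Qed.

Lemma trace_mxfun_scalar {R : rcfType} (g : R -> R) (x : R) n :
  trace_mxfun g ((x%:C)%:M : 'M[R[i]]_n) = g x *+ n.
Proof.
have U1 : (1%:M : 'M[R[i]]_n) \is unitarymx.
  by apply/unitarymxP; rewrite trmx1 map_mx1 mulmx1.
have -> : (x%:C)%:M = 1%:M *m
    diag_mx (map_mx (real_complex R) (const_mx x)) *m (1%:M : 'M[R[i]]_n) ^t*.
  by rewrite mul1mx trmx1 map_mx1 mulmx1 map_const_mx diag_const_mx.
rewrite /trace_mxfun (mxfunE _ _ U1) mul1mx trmx1 map_mx1 mulmx1.
by rewrite map_const_mx diag_const_mx mxtrace_scalar raddfMn.
Qed.

(** The scalar case, from the 1 x 1 matrices [x], [y - x] and [1]. *)
Lemma operator_antitone_nonincreasing {R : rcfType} {g : R -> R} :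
  operator_antitone g -> forall x y, 0 < x -> x <= y -> g y <= g x.
Proof.
move=> hg x y x0 xy.
have := operator_antitone_trace (((x%:C)%:M : 'M[R[i]]_1))
  (((y - x)%:C)%:M) ((1%:C)%:M) hg (posdefmx_scalar _ x0).
rewrite !mulmx1 -raddfD -rmorphD /= subrKC => H.
have := @trace_mxfun_scalar R g x 1; have := @trace_mxfun_scalar R g y 1.
rewrite /trace_mxfun !mulr1n => <- <-; apply: H; apply: psdmx_scalar => //.
by rewrite subr_ge0.
Qed.

(** * Discretized path from a positive definite base *)

(** One step of length [h]: [y] and [x] are traces of [f] along the paths with and without [C],
    primes mark the end of the step, and [u], [v], [w] are traces of [df] against [B]. *)
Lemma gap_step {F : realFieldType} (h y y' x x' u v w : F) : 0 <= h ->
  y' - y <= h * u -> x - x' <= - h * w -> u <= v ->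
  y' - x' - (y - x) <= h * (v - w).
Proof. by move=> h0 yu xw /(ler_wpM2l h0); lra. Qed.

Lemma gap_final {F : realFieldType} (x0 x1 y0 y1 e : F) :
  y1 - x1 - (y0 - x0) <= e -> y1 + x0 <= x1 + y0 + e.
Proof. lra. Qed.

Lemma trace_mxfun_submod_gap {R : rcfType} (f df : R -> R) {n}
    (A B C : 'M[R[i]]_n) :
  (forall a b, 0 < a -> 0 < b -> f b - f a <= df a * (b - a)) ->
  operator_antitone df -> posdefmx A -> psdmx B -> psdmx C ->
  exists c, forall k, trace_mxfun f (A + B + C) + trace_mxfun f A <=
    trace_mxfun f (A + B) + trace_mxfun f (A + C) + k.+1%:R^-1 * c.
Proof.
move=> f_tangent hdf Ap Bp Cp.
have tangent (X Y : 'M[R[i]]_n) : posdefmx X -> posdefmx Y ->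
    trace_mxfun f Y - trace_mxfun f X <=
    complex.Re (\tr (mxfun df X *m (Y - X))).
  move=> Xp Yp; apply: klein; [exact: Xp.1|exact: Yp.1|move=> i j].
  by apply: f_tangent; apply: posdefmx_eigs_gt0.
pose X (s : R) : 'M[R[i]]_n := A + (s%:C *: B : 'M[R[i]]_n).
have Xp s : 0 <= s -> posdefmx (X s).
  by move=> s0; exact: (posdefmxD _ _ Ap (psdmxZ _ _ s0 Bp)).
have Yp s : 0 <= s -> posdefmx (X s + C).
  by move=> s0; exact: (posdefmxD _ _ (Xp _ s0) Cp).
have X0 : X 0 = A by rewrite /X scale0r addr0.
have X1 : X 1 = A + B by rewrite /X scale1r.
have XD s h : X (s + h) - X s = h%:C *: B.
  by rewrite /X rmorphD scalerDl addrA (addrC (A + _ + _)) addKr.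
have YD s h : X (s + h) + C - (X s + C) = h%:C *: B.
  by rewrite [X s + C]addrC addrKA; exact: XD.
have XN s h : X s - X (s + h) = (- h)%:C *: B.
  by rewrite rmorphN scaleNr -(XD s) opprB.
(* From here on [X] is known only through its definiteness, endpoints and increments. *)
clearbody X.
pose t s := complex.Re (\tr (mxfun df (X s) *m B)).
have trZ Z (r : R) :
    complex.Re (\tr (Z *m (r%:C *: B))) = r * complex.Re (\tr (Z *m B)).
  by rewrite -scalemxAr mxtraceZ; case: (\tr _) => a b /=; ring.
pose gap s := trace_mxfun f (X s + C) - trace_mxfun f (X s).
have step (s h : R) : 0 <= s -> 0 <= h ->
    gap (s + h) - gap s <= h * (t s - t (s + h)).
  move=> s0 h0; have sh0 : 0 <= s + h by rewrite addr_ge0.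
  have HY : trace_mxfun f (X (s + h) + C) - trace_mxfun f (X s + C) <=
      h * complex.Re (\tr (mxfun df (X s + C) *m B)).
    by rewrite -trZ -(YD s); apply: tangent; [exact: Yp|exact: Yp].
  (* The tangent is taken at the end [X (s + h)] and followed backwards, hence the factor [- h]. *)
  have HX : trace_mxfun f (X s) - trace_mxfun f (X (s + h)) <= - h * t (s + h).
    by rewrite /t -trZ -(XN s); apply: tangent; [exact: Xp|exact: Xp].
  have HYX := operator_antitone_trace _ _ _ hdf (Xp _ s0) Cp Bp.
  exact: gap_step h0 HY HX HYX.
have telescope (h : R) k : 0 <= h ->
    gap (k%:R * h) - gap 0 <= h * (t 0 - t (k%:R * h)).
  move=> h0; clearbody gap t; elim: k => [|k IH].
    by rewrite mul0r !subrr mulr0.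
  have kh0 : 0 <= k%:R * h by rewrite mulr_ge0.
  have := step _ _ kh0 h0; rewrite -[in _.+1%:R]natr1 mulrDl mul1r; lra.
(* What telescoping leaves: [k + 1] steps of length [1 / (k + 1)] end at parameter 1, and this
   constant is independent of [k]. *)
exists (t 0 - t 1) => k.
have k0 : 0 <= k.+1%:R^-1 :> R by rewrite invr_ge0.
have := telescope _ k.+1 k0; rewrite mulfV ?pnatr_eq0 // /gap X0 X1.
exact: gap_final.
Qed.

(** * Separating zero and nonzero eigenvalues *)

(** The part of the trace of [f(A + eI)] that stays continuous as [e] decreases to 0 when [A] is
    semidefinite and [f] is continuous on the positive reals. *)
Definition sum_nz_eigs {R : rcfType} (f : R -> R) {n} (A : 'M[R[i]]_n) (e : R) :=
  \sum_(i | eigs A 0 i != 0) f (eigs A 0 i + e).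

(** By [rank_eigs] there are [n - \rank A] zero eigenvalues, each contributing [f e]. *)
Lemma sum_eigs_shift {R : rcfType} (f : R -> R) {n} (A : 'M[R[i]]_n) (e : R) :
  A \is hermsymmx -> \sum_i f (eigs A 0 i + e) =
  sum_nz_eigs f A e + f e *+ (n - \rank A).
Proof.
move=> Ah; rewrite (bigID (fun i => eigs A 0 i != 0)) /=; congr (_ + _).
transitivity (\sum_(i | ~~ (eigs A 0 i != 0)) f e).
  by apply: eq_bigr => i /negPn/eqP ->; rewrite add0r.
rewrite sumr_const (rank_eigs A Ah) -[X in (X - _)%N](card_ord n).
by rewrite -(cardC [pred i | eigs A 0 i != 0]) addKn.
Qed.

Lemma trace_mxfun_shift_nz {R : rcfType} (f : R -> R) {n} (A : 'M[R[i]]_n) (e : R) :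
  A \is hermsymmx ->
  trace_mxfun f (A + (e%:C)%:M) = sum_nz_eigs f A e + f e *+ (n - \rank A).
Proof. by move=> Ah; rewrite trace_mxfun_shift // sum_eigs_shift. Qed.

Lemma trace_mxfun_nz {R : rcfType} (f : R -> R) {n} (A : 'M[R[i]]_n) :
  A \is hermsymmx ->
  trace_mxfun f A = sum_nz_eigs f A 0 + f 0 *+ (n - \rank A).
Proof.
move=> Ah; rewrite trace_mxfunE -sum_eigs_shift //.
by apply: eq_bigr => i _; rewrite addr0.
Qed.

Lemma sum_nz_eigs_submod_gap {R : rcfType} (f df : R -> R) {n}
    (A B C : 'M[R[i]]_n) (e : R) :
  (forall a b, 0 < a -> 0 < b -> f b - f a <= df a * (b - a)) ->
  operator_antitone df -> psdmx A -> psdmx B -> psdmx C -> 0 < e ->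
  exists c, forall k,
    (sum_nz_eigs f (A + B + C) e + f e *+ (n - \rank (A + B + C)%R)) +
    (sum_nz_eigs f A e + f e *+ (n - \rank A)) <=
    (sum_nz_eigs f (A + B) e + f e *+ (n - \rank (A + B)%R)) +
    (sum_nz_eigs f (A + C) e + f e *+ (n - \rank (A + C)%R)) + k.+1%:R^-1 * c.
Proof.
move=> f_tangent hdf Ap Bp Cp e0.
have ABp := psdmxD _ _ Ap Bp; have ACp := psdmxD _ _ Ap Cp.
have ABCp := psdmxD _ _ ABp Cp.
have Aep : posdefmx (A + (e%:C)%:M).
  by rewrite addrC; exact: (posdefmxD _ _ (posdefmx_scalar _ e0) Ap).
have EB : A + (e%:C)%:M + B = A + B + (e%:C)%:M by exact: addrAC.
have EC : A + (e%:C)%:M + C = A + C + (e%:C)%:M by exact: addrAC.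
have EBC : A + B + (e%:C)%:M + C = A + B + C + (e%:C)%:M by exact: addrAC.
have := trace_mxfun_submod_gap _ _ _ _ _ f_tangent hdf Aep Bp Cp.
rewrite EB EC EBC.
rewrite (trace_mxfun_shift_nz f A e Ap.1) (trace_mxfun_shift_nz f _ e ABp.1).
by rewrite (trace_mxfun_shift_nz f _ e ACp.1) (trace_mxfun_shift_nz f _ e ABCp.1).
Qed.

(** * Concavity and passage to the limit *)

(** By the mean value theorem the slope between [a] and [b] is the derivative at a point in between,
    which monotonicity compares with that at [a]; for [b < a] both this comparison and the sign of
    [b - a] flip. *)
Lemma concave_tangent {R : realType} (f : R -> R) :
  (forall x, 0 < x -> derivable f x 1) ->
  (forall x y : R, 0 < x -> x <= y -> (derive1 f) y <= (derive1 f) x) ->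
  forall a b : R, 0 < a -> 0 < b -> f b - f a <= (derive1 f) a * (b - a).
Proof.
move=> df f'_ni a b a0 b0.
have fmvt x y : 0 < x -> x < y ->
    exists2 c, c \in `]x, y[%R & f y - f x = (derive1 f) c * (y - x).
  move=> x0 xy; apply: (@MVT R f (derive1 f)) => //.
    move=> z; rewrite in_itv /= => /andP[xz _]; rewrite derive1E.
    by apply/derivableP/df; rewrite (lt_trans x0).
  apply: derivable_within_continuous => z; rewrite in_itv /= => /andP[xz _].
  by apply: df; rewrite (lt_le_trans x0).
have [ab|ba|->] := ltgtP a b; last by rewrite !subrr mulr0.
- have [c] := fmvt _ _ a0 ab; rewrite in_itv /= => /andP[ac _] ->.
  by rewrite ler_wpM2r ?f'_ni ?subr_ge0 // ltW.
- have [c] := fmvt _ _ b0 ba; rewrite in_itv /= => /andP[bc ca] fE.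
  have := f'_ni c a (lt_trans b0 bc) (ltW ca); nra.
Qed.

Lemma le_of_harmonic_gap {R : realType} (x y c : R) :
  (forall k, x <= y + k.+1%:R^-1 * c) -> x <= y.
Proof.
move=> gap; apply/ler_addgt0Pr => e e0; pose N := Num.bound (`|c| / e).
apply: le_trans (gap N) _; rewrite lerD2l ler_pdivrMl //.
apply: le_trans (ler_norm _) _; rewrite -ler_pdivrMr //.
apply: le_trans (ltW (archi_boundP _)) _; first by rewrite divr_ge0 // ltW.
by rewrite ler_nat.
Qed.

Lemma cvg_sum {R : realType} {T : Type} {F : set_system T} {FF : Filter F}
    (I : Type) (r : seq I) (P : pred I) (g : I -> T -> R) (l : I -> R) :
  (forall i, P i -> g i x @[x --> F] --> l i) ->
  \sum_(i <- r | P i) g i x @[x --> F] --> \sum_(i <- r | P i) l i.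
Proof.
move=> gl; elim: r => [|i r IHr].
  by under eq_fun do rewrite big_nil; rewrite big_nil; apply: cvg_cst.
under eq_fun do rewrite big_cons; rewrite big_cons.
by case: ifP => // Pi; apply: cvgD => //; apply: gl.
Qed.

(* The zero eigenvalues contribute [k] times [f e], where [k >= 0] because the
   rank is submodular: this is why lower semicontinuity of [f] at 0 suffices. *)
Lemma limit_submod {R : realType} (f : R -> R) (SA SAB SAC SABC : R -> R)
    (n rA rAB rAC rABC : nat) :
  (forall e : R, 0 < e -> \forall x \near 0^'+, f 0 - e < f x) ->
  SA e @[e --> 0^'+] --> SA 0 -> SAB e @[e --> 0^'+] --> SAB 0 ->
  SAC e @[e --> 0^'+] --> SAC 0 -> SABC e @[e --> 0^'+] --> SABC 0 ->
  (rA <= n)%N -> (rAB <= n)%N -> (rAC <= n)%N -> (rABC <= n)%N ->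
  (rABC + rA <= rAB + rAC)%N ->
  (forall e, 0 < e -> exists c, forall k,
    (SABC e + f e *+ (n - rABC)) + (SA e + f e *+ (n - rA)) <=
    (SAB e + f e *+ (n - rAB)) + (SAC e + f e *+ (n - rAC)) + k.+1%:R^-1 * c) ->
  (SABC 0 + f 0 *+ (n - rABC)) + (SA 0 + f 0 *+ (n - rA)) <=
  (SAB 0 + f 0 *+ (n - rAB)) + (SAC 0 + f 0 *+ (n - rAC)).
Proof.
move=> f0 cA cAB cAC cABC nA nAB nAC nABC rk Se.
(* The excess of zero eigenvalues of [A + B + C] and [A] over those of [A + B] and [A + C]; by [rk]
   the subtraction is not truncated. *)
pose k := (rAB + rAC - (rABC + rA))%N.
have kE (x : R) : x *+ (n - rABC) + x *+ (n - rA) =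
    x *+ (n - rAB) + x *+ (n - rAC) + x *+ k.
  by rewrite -!mulrnDr; congr (_ *+ _); rewrite /k; lia.
pose phi e := SAB e + SAC e - SABC e - SA e.
have c_phi : phi e @[e --> 0^'+] --> phi 0.
  by apply: cvgB => //; apply: cvgB => //; apply: cvgD.
(* Dividing by [k + 1] covers [k = 0] and still gives [k d' <= d]. *)
apply/ler_addgt0Pr => d d0; pose d' := d / k.+1%:R.
have d'0 : 0 < d' by rewrite divr_gt0.
have d'd : d' *+ k <= d.
  by rewrite -mulr_natr mulrAC ler_pdivrMr // ler_pM2l // ler_nat.
(* By [kE], the bound at [e] reads [k f(e) <= phi e]. Near 0 its left side is at least
   [k (f 0 - d')], a constant that survives the limit. *)
have : (f 0 - d') *+ k <= phi 0.
  apply: (cvgr_to_ge c_phi); near=> e.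
  have e0 : 0 < e by [].
  have [c /le_of_harmonic_gap] := Se e e0.
  have : (f 0 - d') *+ k <= f e *+ k.
    by rewrite lerMn2r ltW ?orbT //; near: e; apply: f0.
  by have := kE (f e); rewrite /phi; lra.
by rewrite mulrnBl /phi; have := kE (f 0); lra.
Unshelve. all: by end_near.
Qed.

Lemma trace_mxfun_submod_psd {R : realType} (f : R -> R) {n}
    (A B C : 'M[R[i]]_n) :
  (forall x, 0 < x -> derivable f x 1) ->
  (forall e : R, 0 < e -> \forall x \near 0^'+, f 0 - e < f x) ->
  operator_antitone f^`() ->
  psdmx A -> psdmx B -> psdmx C ->
  trace_mxfun f (A + B + C) + trace_mxfun f A <=
  trace_mxfun f (A + B) + trace_mxfun f (A + C).
Proof.
move=> df f0 hf Ap Bp Cp.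
have ABp := psdmxD _ _ Ap Bp; have ACp := psdmxD _ _ Ap Cp.
have ABCp := psdmxD _ _ ABp Cp.
have S_cvg (X : 'M[R[i]]_n) : psdmx X -> sum_nz_eigs f X e @[e --> 0^'+] --> sum_nz_eigs f X 0.
  (* Nonzero eigenvalues of [X] are positive, and there [f] is differentiable, hence continuous. *)
  move=> Xp; apply: cvg_sum => i Xi0; rewrite addr0.
  have Xi : 0 < eigs X 0 i by rewrite lt_neqAle eq_sym Xi0 psdmx_eigs_ge0.
  apply: cvg_at_right_filter.
  have l_cvg : eigs X 0 i + e @[e --> (0 : R)] --> eigs X 0 i.
    by rewrite -[X in _ --> X]addr0; apply: cvgD; [exact: cvg_cst|exact: cvg_id].
  have fc : {for eigs X 0 i, continuous f}.
    by apply: differentiable_continuous; apply/derivable1_diffP; apply: df.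
  exact: (cvg_comp _ _ l_cvg fc).
have f_tangent := concave_tangent f df (operator_antitone_nonincreasing hf).
have Se e (e0 : 0 < e) := sum_nz_eigs_submod_gap _ _ _ _ _ _ f_tangent hf Ap Bp Cp e0.
rewrite (trace_mxfun_nz f _ Ap.1) (trace_mxfun_nz f _ ABp.1).
rewrite (trace_mxfun_nz f _ ACp.1) (trace_mxfun_nz f _ ABCp.1).
apply: (limit_submod f _ _ _ _ n _ _ _ _ f0 (S_cvg _ Ap) (S_cvg _ ABp)
  (S_cvg _ ACp) (S_cvg _ ABCp)); last exact: Se; try exact: rank_leq_row.
exact: psdmx_rank_submod.
Qed.

Theorem corollary2p4 (R : realType) (m s : nat) (M : 'I_s -> 'M[R[i]]_m)
    (f : R -> R)
    (hM : forall i : 'I_s, psdmx (M i))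
    (hf : forall x : R, 0 < x -> derivable f x 1)
    (hf0 : forall e : R, 0 < e -> \forall x \near 0^'+, f 0 - e < f x)
    (hf' : operator_antitone f^`()) :
  submodular (fun I : {set 'I_s} => trace_mxfun f (\sum_(i in I) M i)).
Proof.
move=> I J.
have IE : \sum_(i in I) M i = \sum_(i in I :&: J) M i + \sum_(i in I :\: J) M i.
  exact: big_setID.
have JE : \sum_(i in J) M i = \sum_(i in I :&: J) M i + \sum_(i in J :\: I) M i.
  by rewrite (finset.setIC I J); exact: big_setID.
(* Splitting the union along [I] leaves exactly [J :\: I], so that [IE] yields the shape
   [A + B + C]. *)
have IJE : \sum_(i in I :|: J) M i = \sum_(i in I) M i + \sum_(i in J :\: I) M i.
  by rewrite (big_setID I) /= finset.setUK finset.setDUl finset.setDv finset.set0U.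
rewrite IJE JE IE; apply: trace_mxfun_submod_psd => //; apply: psdmx_sum => i;
  exact: hM.
Qed.
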